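(* Let $\mathcal{H}$ be a Hilbert space, $\mathcal{D}\subset\mathcal{H}$ a dense subspace, $f$ a real-valued, strictly increasing function, and let $(a,b,h)$ be compatible operators with respect to $\mathcal{D}$ and $f$; that is, $a,b,h$ are defined on $\mathcal{D}$, $\mathcal{D}$ is stable under $a,b,h$ and their adjoints $a^\dagger,b^\dagger,h^\dagger$, and for all $\varphi\in\mathcal{D}$ $$hb\,\varphi=b f(h)\,\varphi,\qquad ah\,\varphi=f(h)a\,\varphi .$$ Let $\epsilon_0\ge 0$ be a real number and define $\epsilon_{n+1}=f(\epsilon_n)$ for $n\ge 0$; assume that $f(\epsilon_0)>\epsilon_0$ (so that $(\epsilon_n)_{n\ge0}$ is strictly increasing). Suppose there exist non-zero vectors $\varphi_0,\psi_0\in\mathcal{D}$ such that $h\varphi_0=\epsilon_0\varphi_0$ and $h^\dagger\psi_0=\epsilon_0\psi_0$. For $n\ge 0$ define $$\varphi_n=\frac{1}{\sqrt{(\epsilon_n-\epsilon_0)!}}\,b^n\varphi_0,\qquad \psi_n=\frac{1}{\sqrt{(\epsilon_n-\epsilon_0)!}}\,(a^\dagger)^n\psi_0 .$$ Then, for all $n\ge 0$, $$h\varphi_n=\epsilon_n\varphi_n,\qquad h^\dagger\psi_n=\epsilon_n\psi_n,$$ and, for all $n,m\ge 0$, $$\langle\psi_n,\varphi_m\rangle=\delta_{n,m}\,\langle\psi_n,\varphi_n\rangle .$$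
   Context: Notation: $(\epsilon_n-\epsilon_0)!:=(\epsilon_n-\epsilon_0)(\epsilon_{n-1}-\epsilon_0)\cdots(\epsilon_1-\epsilon_0)$ for $n\ge1$, and $(\epsilon_0-\epsilon_0)!=0!:=1$. The operators $a,b,h$ may be unbounded and $h$ need not be self-adjoint. Stability of $\mathcal{D}$ means that $\mathcal{D}$ is contained in the domain of each of the operators $a,b,h,a^\dagger,b^\dagger,h^\dagger$ and is mapped into itself by each of them. The operator $f(h)$ is understood as a given operator on $\mathcal{D}$, mapping $\mathcal{D}$ into $\mathcal{D}$, with $\mathcal{D}$ contained in the domain of its adjoint $f(h)^\dagger$, obtained from some functional calculus for $h$ (power series, spectral theorem, similarity to a self-adjoint operator, or action on eigenvectors). It is compatible with eigenvectors: if $v\in\mathcal{D}$ and $hv=\mu v$ with $\mu$ real and in the domain of $f$, then $f(h)v=f(\mu)v$; and if $w\in\mathcal{D}$ and $h^\dagger w=\mu w$ with $\mu$ real and in the domain of $f$, then $f(h)^\dagger w=f(\mu)w$. The domain of $f$ contains all the numbers $\epsilon_n$, $n\ge0$. *)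

(* Defs.v *)
From HB Require Import structures.
From mathcomp Require Import all_boot all_order all_algebra.
From mathcomp Require Import sesquilinear complex.
From mathcomp Require Import boolp classical_sets reals topology normedtype.

Set Implicit Arguments.
Unset Strict Implicit.
Unset Printing Implicit Defensive.

Import Order.TTheory GRing.Theory Num.Theory Num.Def.
Import numFieldNormedType.Exports.

Local Open Scope classical_set_scope.
Local Open Scope ring_scope.
Local Open Scope complex_scope.

(* A complex Hilbert space is a complete normed space over R[i] whose norm is
   the one of [dot]. The form is linear in its first argument and conjugate
   linear in the second one. *)
Definition hilbert_inner_product (R : realType) (H : completeNormedModType R[i])
    (dot : {dot H for conjC}) : Prop :=
  forall x : H, `|x| ^+ 2 = dot x x.

(* A possibly unbounded operator; the values of [op] outside [dom] carry no
   meaning. Linearity is stated separately, so that the adjoint can be defined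
   without assuming that [dom] is dense. *)
Record operator (R : realType) (H : completeNormedModType R[i]) := Operator {
  dom : set H;
  op :> H -> H }.

Definition linear_operator (R : realType) (H : completeNormedModType R[i])
    (T : operator H) : Prop :=
  submod_closed (mem (dom T)) /\
  forall (c : R[i]) (u v : H), dom T u -> dom T v ->
    T (c *: u + v) = c *: T u + T v.

Definition adjoint_values (R : realType) (H : completeNormedModType R[i])
    (dot : {dot H for conjC}) (T : operator H) (w : H) : set H :=
  [set u | forall v, dom T v -> dot (T v) w = dot v u].

(* When [dom T] is dense, [adjoint_values dot T w] has at most one element, so
   that [xget] makes no arbitrary choice on the domain of the adjoint. *)
Definition adjoint (R : realType) (H : completeNormedModType R[i])
    (dot : {dot H for conjC}) (T : operator H) : operator H :=
  Operator [set w | adjoint_values dot T w !=set0]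
           (fun w => xget 0 (adjoint_values dot T w)).

Definition stable (R : realType) (H : completeNormedModType R[i])
    (D : set H) (T : operator H) : Prop :=
  D `<=` dom T /\ forall v, D v -> D (T v).

(* What is required of [fh] as "f(h)", for a real function [f] of domain [Df]
   (its values outside [Df] carry no meaning). *)
Record function_of_operator (R : realType) (H : completeNormedModType R[i])
    (dot : {dot H for conjC}) (D : set H) (Df : set R) (f : R -> R)
    (h fh : operator H) : Prop := FunctionOfOperator {
  fo_linear : linear_operator fh;
  fo_stable : stable D fh;
  fo_adjoint_dom : D `<=` dom (adjoint dot fh);
  fo_eigen : forall (mu : R) (v : H), Df mu -> D v ->
    h v = mu%:C *: v -> fh v = (f mu)%:C *: v;
  fo_adjoint_eigen : forall (mu : R) (w : H), Df mu -> D w ->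
    adjoint dot h w = mu%:C *: w -> adjoint dot fh w = (f mu)%:C *: w }.

Record compatible (R : realType) (H : completeNormedModType R[i])
    (dot : {dot H for conjC}) (D : set H) (Df : set R) (f : R -> R)
    (a b h fh : operator H) : Prop := Compatible {
  compat_linear : [/\ linear_operator a, linear_operator b & linear_operator h];
  compat_stable : [/\ stable D a, stable D b & stable D h];
  compat_adjoint_stable :
    [/\ stable D (adjoint dot a), stable D (adjoint dot b)
      & stable D (adjoint dot h)];
  compat_fh : function_of_operator dot D Df f h fh;
  compat_hb : forall v, D v -> h (b v) = b (fh v);
  compat_ah : forall v, D v -> a (h v) = fh (a v) }.

Definition shifted_fact (R : realType) (eps : nat -> R) (n : nat) : R :=
  \prod_(1 <= k < n.+1) (eps k - eps 0%N).

Definition ladder (R : realType) (H : completeNormedModType R[i])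
    (eps : nat -> R) (T : H -> H) (v : H) (n : nat) : H :=
  ((Num.sqrt (shifted_fact eps n))^-1)%:C *: iter n T v.

(* Main.v *)
(* By the intertwining relations [b] and [a^+] raise the eigenvalue [mu] of an
   eigenvector of [h], resp. [h^+], to [f mu]; eigenvectors of [h] and [h^+] for
   distinct real eigenvalues are orthogonal. The relation for [h^+ a^+] is only
   available weakly, against [D], whence the use of density. *)
Require Import Defs.
From HB Require Import structures.
From mathcomp Require Import all_boot all_order all_algebra.
From mathcomp Require Import sesquilinear complex.
From mathcomp Require Import boolp classical_sets reals topology normedtype.

Import Order.TTheory GRing.Theory Num.Theory Num.Def.
Import numFieldNormedType.Exports.

Local Open Scope classical_set_scope.
Local Open Scope ring_scope.
Local Open Scope complex_scope.

Section DenseDomain.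
Set Implicit Arguments.
Unset Strict Implicit.
Unset Printing Implicit Defensive.

Context (R : realType) (H : completeNormedModType R[i]).
Context (dot : {dot H for conjC}) (hdot : hilbert_inner_product dot).
Implicit Types (T : operator H) (D : set H) (v w : H).

Lemma conjC_complex (r : R) : conjC (r%:C : R[i]) = r%:C.
Proof. by apply: conj_Creal; apply/complex_realP; exists r. Qed.

Lemma dotC v w : dot v w = conjC (dot w v).
Proof. by rewrite hermC expr0 mul1r. Qed.

Lemma dotZl (c : R[i]) v w : dot (c *: v) w = c * dot v w.
Proof. exact: linearZl_LR. Qed.

Lemma dotZr (c : R[i]) v w : dot v (c *: w) = conjC c * dot v w.
Proof. by rewrite dotC dotZl rmorphM /= -dotC. Qed.

(* Pythagoras: a vector [d] orthogonal to [w] satisfies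
   [`|w| <= `|w - d|], so no such [d] is closer to [w] than the origin. *)
Lemma dense_orthogonal D w :
  dense D -> (forall v, D v -> dot v w = 0) -> w = 0.
Proof.
move=> densD orthw; apply/eqP/contraT => w_neq0.
have w_gt0 : 0 < `|w| by rewrite normr_gt0.
(* The radius [|w|] is positive because [w] is non-zero; density then yields a [d] in [D] strictly
   closer to [w] than the origin. *)
have [d [wd Dd]] := densD (ball w `|w|)
  (ex_intro _ w (ballxx w w_gt0)) (ball_open w `|w|).
move: wd; rewrite -ball_normE /= => wd.
have dot_wd : dot w d = 0 by rewrite dotC orthw // rmorph0.
have : `|w| ^+ 2 <= `|w - d| ^+ 2.
  have dd_ge0 : 0 <= dot d d by rewrite -hdot exprn_ge0.
  by rewrite !hdot hnormBd // lerDl.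
by rewrite ler_pXn2r ?nnegrE // => /(lt_le_trans wd); rewrite ltxx.
Qed.

Lemma dot_adjoint T v w :
  dom T v -> dom (adjoint dot T) w -> dot (T v) w = dot v (adjoint dot T w).
Proof. by move=> Tv /(xgetPex 0); apply. Qed.

(** Two candidate values differ by a vector orthogonal to the dense [D]. Testing on [D] alone does
    not put [w] in the domain of the adjoint, hence the separate assumption. *)
Lemma adjoint_unique T D w u :
  dense D -> D `<=` dom T -> dom (adjoint dot T) w ->
  (forall v, D v -> dot (T v) w = dot v u) -> adjoint dot T w = u.
Proof.
move=> densD DT Tw Twu; apply/eqP; rewrite -subr_eq0; apply/eqP.
apply: (dense_orthogonal densD) => v Dv.
by rewrite linearBr /= -dot_adjoint ?Twu ?subrr //; apply: DT.
Qed.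

(** The value of [adjoint] is picked by [xget], so homogeneity has to come from uniqueness. *)
Lemma adjointZ T D (c : R[i]) w :
  dense D -> D `<=` dom T -> dom (adjoint dot T) w ->
  dom (adjoint dot T) (c *: w) /\
  adjoint dot T (c *: w) = c *: adjoint dot T w.
Proof.
move=> densD DT Tw.
have TcwE v : dom T v -> dot (T v) (c *: w) = dot v (c *: adjoint dot T w).
  by move=> Tv; rewrite !dotZr dot_adjoint.
have Tcw : dom (adjoint dot T) (c *: w) by exists (c *: adjoint dot T w).
by split=> //; apply: (adjoint_unique densD) => // v Dv; apply/TcwE/DT.
Qed.

Lemma linear_operatorZ T (c : R[i]) v :
  linear_operator T -> dom T v -> T (c *: v) = c *: T v.
Proof.
move=> [[T0 _] linT] Tv.
have {}T0 : dom T 0 by move: T0; rewrite inE.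
(* Linearity at [1 *: 0 + 0] reads [T 0 = T 0 + T 0]; cancel. *)
have T00 : T 0 = 0.
  by have := linT 1 0 0 T0 T0; rewrite !scale1r addr0 -[LHS]addr0 => /addrI.
by rewrite -[c *: v]addr0 linT // T00 addr0.
Qed.

Lemma submod_closed_scale D (c : R[i]) v :
  submod_closed (mem D) -> D v -> D (c *: v).
Proof.
move=> [D0 linD] Dv; rewrite -[c *: v]addr0.
by have := linD c v 0; rewrite !inE; apply => //; move: D0; rewrite inE.
Qed.

Lemma iter_stable D T n v : stable D T -> D v -> D (iter n T v).
Proof. by move=> [_ DT] Dv; elim: n => //= n /DT. Qed.

Section Ladder.
Context (D : set H) (D_dense : dense D).
Context (Df : set R) (f : R -> R) (a b h fh : operator H).
Context (habh : compatible dot D Df f a b h fh).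

(** [h b v = b f(h) v], and [f(h)] acts on the eigenvector [v] as the scalar [f mu], which passes
    through [b]. *)
Lemma raising_eigen (mu : R) v :
  Df mu -> D v -> h v = mu%:C *: v -> h (b v) = (f mu)%:C *: b v.
Proof.
case: habh => -[_ linb _] [_ [Db _] _] _ [_ _ _ eigen _] hb _ Dfmu Dv hv.
by rewrite hb // (eigen mu) // linear_operatorZ //; apply: Db.
Qed.

(* [h^+ a^+ = (a h)^+ = (f(h) a)^+ = a^+ f(h)^+], tested against [D]. *)
Lemma adjoint_raising_eigen (mu : R) w :
  Df mu -> D w -> adjoint dot h w = mu%:C *: w ->
  adjoint dot h (adjoint dot a w) = (f mu)%:C *: adjoint dot a w.
Proof.
case: habh => _ [[Da aD] _ [Dh hD]] [[Daa aaD] _ [Dha _]].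
move=> [_ [Dfh _] Dfha _ eigen] _ ah Dfmu Dw hw.
apply: (adjoint_unique D_dense Dh) => [|v Dv]; first exact/Dha/aaD.
rewrite -dot_adjoint; [|exact/Da/hD|exact: Daa].
rewrite ah // dot_adjoint; [|exact/Dfh/aD|exact: Dfha].
by rewrite (eigen mu) // !dotZr dot_adjoint //; [exact: Da|exact: Daa].
Qed.

End Ladder.

(** Moving [T] across the form gives [lam * dot v w = mu * dot v w]; the conjugation on [mu]
    disappears because [mu] is real. *)
Lemma adjoint_eigen_orthogonal T v w (lam mu : R) :
  dom T v -> dom (adjoint dot T) w ->
  T v = lam%:C *: v -> adjoint dot T w = mu%:C *: w -> lam != mu ->
  dot w v = 0.
Proof.
move=> Tv Tw TvE TwE; have := dot_adjoint Tv Tw.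
rewrite TvE TwE dotZl dotZr conjC_complex => /eqP.
rewrite -subr_eq0 -mulrBl mulf_eq0 -rmorphB fmorph_eq0 subr_eq0.
by case/orP => [->//|/eqP vw _]; rewrite dotC vw rmorph0.
Qed.

End DenseDomain.

Theorem proposition3 (R : realType) (H : completeNormedModType R[i])
    (dot : {dot H for conjC}) (hdot : hilbert_inner_product dot)
    (D : set H) (D_subspace : submod_closed (mem D)) (D_dense : dense D)
    (Df : set R) (f : R -> R)
    (f_incr : {in Df &, {homo f : x y / x < y}})
    (a b h fh : operator H) (habh : compatible dot D Df f a b h fh)
    (eps : nat -> R) (eps0_ge0 : 0 <= eps 0%N)
    (epsS : forall n, eps n.+1 = f (eps n))
    (eps_dom : forall n, Df (eps n))
    (f_eps0 : eps 0%N < f (eps 0%N))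
    (phi0 psi0 : H) (phi0_D : D phi0) (psi0_D : D psi0)
    (phi0_neq0 : phi0 != 0) (psi0_neq0 : psi0 != 0)
    (h_phi0 : h phi0 = (eps 0%N)%:C *: phi0)
    (h_psi0 : adjoint dot h psi0 = (eps 0%N)%:C *: psi0) :
  let phi := ladder eps b phi0 in
  let psi := ladder eps (adjoint dot a) psi0 in
  [/\ forall n, dom h (phi n) /\ h (phi n) = (eps n)%:C *: phi n,
      forall n, dom (adjoint dot h) (psi n) /\
                adjoint dot h (psi n) = (eps n)%:C *: psi n
    & forall n m, dot (psi n) (phi m) = (n == m)%:R * dot (psi n) (phi n)].
Proof.
move=> phi psi.
have [[_ linb linh] [_ Db [Dh _]] [Daa _ [Dha _]] _ _ _] := habh.
(* The inductions run on the bare iterates; the normalising factors are put back afterwards by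
   homogeneity of [h] and of its adjoint. *)
have b_eigen n : h (iter n b phi0) = (eps n)%:C *: iter n b phi0.
  elim: n => // n IHn; rewrite iterS epsS.
  by apply: (raising_eigen habh) => //; apply: iter_stable.
have a_eigen n : adjoint dot h (iter n (adjoint dot a) psi0) =
    (eps n)%:C *: iter n (adjoint dot a) psi0.
  elim: n => // n IHn; rewrite iterS epsS.
  by apply: (adjoint_raising_eigen hdot D_dense habh) => //; apply: iter_stable.
have phi_eigen n : dom h (phi n) /\ h (phi n) = (eps n)%:C *: phi n.
  have Dn : D (iter n b phi0) by apply: iter_stable.
  split; first by apply: Dh; apply: submod_closed_scale.
  rewrite /phi /ladder linear_operatorZ //; last exact: Dh.
  by rewrite b_eigen !scalerA mulrC.
have psi_eigen n : dom (adjoint dot h) (psi n) /\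
    adjoint dot h (psi n) = (eps n)%:C *: psi n.
  have Dn : D (iter n (adjoint dot a) psi0) by apply: iter_stable.
  rewrite /psi /ladder.
  set c := (X in X *: iter _ _ _).
  have [domc ->] := adjointZ hdot c D_dense Dh (Dha _ Dn).
  by rewrite a_eigen !scalerA mulrC.
have eps_incr n : eps n < eps n.+1.
  elim: n => [|n IHn]; first by rewrite epsS.
  by rewrite [ltLHS]epsS [ltRHS]epsS; apply: f_incr; rewrite ?inE.
(* Strict growth makes the eigenvalues at distinct indices distinct, as orthogonality requires. *)
have eps_inj : injective eps.
  exact: inc_inj (le_mono (Order.NatMonotonyTheory.homo_ltn_lt eps_incr)).
split=> // n m; have [->|neq_nm] := eqVneq n m; first by rewrite mul1r.
rewrite mul0r; have [hm hmE] := phi_eigen m; have [hn hnE] := psi_eigen n.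
by apply: (adjoint_eigen_orthogonal hm hn hmE hnE); rewrite (inj_eq eps_inj) eq_sym.
Qed.
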